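(* Let $m\geq 2$ be an integer and let $\lambda_m,\lambda_{m-1}$ be real numbers such that $\lambda_m$ is not one of the seven values $2$, $2\pm\sqrt2$, $2\pm\sqrt{2+\sqrt2}$, $2\pm\sqrt{2-\sqrt2}$. Suppose that $u:V_m\to\mathbb{R}$ satisfies $-\Delta_m u=\lambda_m u$ on $V_m\setminus V_0$, and that its restriction to $V_{m-1}$ is not identically zero and satisfies $-\Delta_{m-1}\left(u_{\mid V_{m-1}}\right)=\lambda_{m-1}\,u_{\mid V_{m-1}}$ on $V_{m-1}\setminus V_0$. Then $$\lambda_{m-1}=-(\lambda_m-4)\,(\lambda_m-2)^2\,\lambda_m\,\left((\lambda_m-4)\,\lambda_m+2\right)^2 .$$
   Context: Let $P_0=(0,0)$, $P_1=(1,0)$ in $\mathbb{R}^2$, and let $\mathcal{R}_\theta$ denote the rotation of $\mathbb{R}^2$ about the origin by the angle $\theta$. Define, for $X\in\mathbb{R}^2$ (vectors written as pairs): $f_1(X)=\frac14\left(X+(0,0)\right)$, $f_2(X)=\frac14\left(\mathcal{R}_{\pi/2}X+(1,0)\right)$, $f_3(X)=\frac14\left(X+(1,1)\right)$, $f_4(X)=\frac14\left(\mathcal{R}_{3\pi/2}X+(2,1)\right)$, $f_5(X)=\frac14\left(\mathcal{R}_{3\pi/2}X+(2,0)\right)$, $f_6(X)=\frac14\left(X+(2,-1)\right)$, $f_7(X)=\frac14\left(\mathcal{R}_{\pi/2}X+(3,-1)\right)$, $f_8(X)=\frac14\left(X+(3,0)\right)$. Set $V_0=\{P_0,P_1\}$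 and $V_m=\bigcup_{i=1}^8 f_i(V_{m-1})$ for $m\geq1$. For a word $\mathcal{W}=(\mathcal{W}_1,\dots,\mathcal{W}_m)\in\{1,\dots,8\}^m$ put $f_{\mathcal W}=f_{\mathcal{W}_1}\circ\cdots\circ f_{\mathcal{W}_m}$. Two points $X,Y\in V_m$ are adjacent, written $X\underset{m}{\sim}Y$, if there is a word $\mathcal W$ of length $m$ with $\{X,Y\}=\{f_{\mathcal W}(P_0),f_{\mathcal W}(P_1)\}$. For $m\geq1$ and $u:V_m\to\mathbb{R}$, the Laplacian of order $m$ is $\Delta_m u(X)=\sum_{Y\in V_m,\,Y\underset{m}{\sim}X}\left(u(Y)-u(X)\right)$ for $X\in V_m\setminus V_0$. *)

(* Defs.v *)
From mathcomp Require Import all_boot all_order all_algebra finmap.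
From mathcomp Require Import all_classical reals trigo.

Set Implicit Arguments.
Unset Strict Implicit.
Unset Printing Implicit Defensive.

Import Order.TTheory GRing.Theory Num.Theory.

Local Open Scope fset_scope.
Local Open Scope ring_scope.

Section Minkowski.
Variable R : realType.

(* [R^o] makes the plane a vector space over [R], so that [+] and [*:] are the
   coordinatewise operations on pairs. *)
Definition plane := (R^o * R^o)%type.

Definition P0 : plane := (0, 0).
Definition P1 : plane := (1, 0).

Definition rot (theta : R) (X : plane) : plane :=
  (cos theta * X.1 - sin theta * X.2, sin theta * X.1 + cos theta * X.2).

Definition f1 (X : plane) : plane := 4^-1 *: (X + (0, 0)).
Definition f2 (X : plane) : plane := 4^-1 *: (rot (pi / 2) X + (1, 0)).
Definition f3 (X : plane) : plane := 4^-1 *: (X + (1, 1)).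
Definition f4 (X : plane) : plane := 4^-1 *: (rot (3 * pi / 2) X + (2, 1)).
Definition f5 (X : plane) : plane := 4^-1 *: (rot (3 * pi / 2) X + (2, 0)).
Definition f6 (X : plane) : plane := 4^-1 *: (X + (2, -1)).
Definition f7 (X : plane) : plane := 4^-1 *: (rot (pi / 2) X + (3, -1)).
Definition f8 (X : plane) : plane := 4^-1 *: (X + (3, 0)).

(* The letters 1, ..., 8 are encoded as 0, ..., 7 : 'I_8. *)
Definition f (i : 'I_8) : plane -> plane :=
  tnth [tuple f1; f2; f3; f4; f5; f6; f7; f8] i.

Definition f_word (W : seq 'I_8) : plane -> plane :=
  foldr (fun i g => f i \o g) id W.

Fixpoint V (m : nat) : {fset plane} :=
  if m is m'.+1 then \bigcup_(i <- enum 'I_8) [fset f i X | X in V m']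
  else [fset P0; P1].

Definition adj (m : nat) (X Y : plane) : bool :=
  [exists W : m.-tuple 'I_8, [fset X; Y] == [fset f_word W P0; f_word W P1]].

(* Meaningful at the points [X] outside [V 0]; the hypotheses on [Laplacian]
   are only ever imposed there. *)
Definition Laplacian (m : nat) (u : V m -> R) (X : V m) : R :=
  \sum_(Y : V m | adj m (val Y) (val X)) (u Y - u X).

Lemma in_VS m (i : 'I_8) X : X \in V m -> f i X \in V m.+1.
Proof.
move=> XV; apply/bigfcupP; exists i; first by rewrite mem_enum.
exact: in_imfset.
Qed.

Lemma VS_inv m Y : Y \in V m.+1 -> exists (i : 'I_8) X, X \in V m /\ Y = f i X.
Proof. by move=> /bigfcupP[i _ /imfsetP[X XV ->]]; exists i, X. Qed.

Lemma V_subS m : V m `<=` V m.+1.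
Proof.
elim: m => [|m IHm]; apply/fsubsetP => X.
  rewrite !inE => /orP[] /eqP ->.
  - have E : f (inord 0) P0 = P0.
      rewrite /f (tnth_nth f1) /= inordK //= /f1.
      by rewrite (_ : (0, 0) = 0 :> plane) // addr0 scaler0.
    by rewrite -[X in X \in _]E; apply: in_VS; rewrite !inE eqxx.
  - have E : f (inord 7) P1 = P1.
      rewrite /f (tnth_nth f1) /= inordK //= /f8 /P1.
      congr pair; first by rewrite /= /GRing.scale /= nat1r mulVf ?pnatr_eq0.
      by rewrite /= addr0; exact: mulr0.
    by rewrite -[X in X \in _]E; apply: in_VS; rewrite !inE eqxx orbT.
by move=> /VS_inv[i [Y [YV ->]]]; apply/in_VS/(fsubsetP IHm).
Qed.

Lemma V_sub_pred m : V m.-1 `<=` V m.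
Proof. by case: m => [|m]; [exact: fsubset_refl | exact: V_subS]. Qed.

Definition restrict_pred (m : nat) (u : V m -> R) (X : V m.-1) : R :=
  u (fincl (V_sub_pred m) X).

End Minkowski.

(* Main.v *)
Require Import Defs.
From mathcomp Require Import all_boot all_order all_algebra finmap.
From mathcomp Require Import all_classical reals trigo.
From mathcomp Require Import zify ring lra.

Import Order.TTheory GRing.Theory Num.Theory.
Local Open Scope ring_scope.

(** The graph [V m] is a path with [8 ^ m] edges: numbering the vertices along
    the curve, consecutive ones are adjacent, and they are pairwise distinct
    because a subdivided edge of the lattice can be recovered from the
    coordinates modulo 4 of any of its interior points. Every eighth vertex of
    level [m + 1] is a vertex of level [m]. On a path the eigenvalue equation reads
    [w k + w k.+2 = a * w k.+1] with [a = 2 - lambda]; it passes to even indices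
    with [a] replaced by [a ^+ 2 - 2], and three such steps relate the two
    levels. If the restriction vanished at all interior vertices, the equation
    next to the end points would make it vanish there too. *)

(** * Integer model of the curve *)

(** In complex notation [f i] is [z |-> (gen_dir i * z + gen_pos i) / 4]. *)
Definition gen_pos (i : nat) : int * int :=
  nth (0, 0) [:: (0, 0); (1, 0); (1, 1); (2, 1); (2, 0); (2, -1); (3, -1); (3, 0)] i.

Definition gen_dir (i : nat) : int * int :=
  nth (0, 0) [:: (1, 0); (0, 1); (1, 0); (0, -1); (0, -1); (1, 0); (0, 1); (1, 0)] i.

(* Pairs of integers stand for Gaussian integers; directions act by multiplication. *)
Definition gmul (z w : int * int) : int * int :=
  (z.1 * w.1 - z.2 * w.2, z.1 * w.2 + z.2 * w.1).

(* [vertex m k] is [4 ^ m] times the [k]-th vertex of level [m]; the indices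
   [k > 8 ^ m] continue with translates of the curve along the real axis, so that
   the recursion needs no bound on [k]. *)
Fixpoint vertex (m k : nat) : int * int :=
  if m is m'.+1 then
    vertex m' (k %/ 8) *+ 4 +
    gmul (vertex m' (k %/ 8).+1 - vertex m' (k %/ 8)) (gen_pos (k %% 8))
  else (k%:Z, 0).

Definition step (m k : nat) : int * int := vertex m k.+1 - vertex m k.

Lemma vertexS m k i : (i < 8)%N ->
  vertex m.+1 (8 * k + i) = vertex m k *+ 4 + gmul (step m k) (gen_pos i).
Proof.
move=> i8; rewrite /step /= mulnC divnMDl // modnMDl divn_small // modn_small //.
by rewrite addn0.
Qed.

(** The successive differences of [gen_pos], closed up by the point [(4, 0)], are the entries of
    [gen_dir]. *)
Lemma stepS m k i : (i < 8)%N ->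
  step m.+1 (8 * k + i) = gmul (step m k) (gen_dir i).
Proof.
move=> i8; rewrite {1}/step; have [i7|] := ltnP i 7.
  rewrite -addnS !vertexS // opprD addrACA subrr add0r.
  move: (step m k) => [a b].
  by do 7![case: i i7 i8 => [_ _|i i7 i8];
    [congr pair; rewrite /gmul /gen_pos /gen_dir /=; ring|]].
(* The last edge of a block ends at the first vertex of the next block. *)
move=> i7; have -> : i = 7 by lia.
rewrite (_ : (8 * k + 7).+1 = 8 * k.+1 + 0)%N; last lia.
rewrite !vertexS //.
have -> : vertex m k.+1 = vertex m k + step m k by rewrite /step addrC subrK.
move: (step m k) (step m k.+1) (vertex m k) => [a b] [c d] [e g].
by congr pair; rewrite /gmul /gen_pos /gen_dir /=; ring.
Qed.

Lemma step0 k : step 0 k = (1, 0).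
Proof. by rewrite /step /=; congr pair => /=; lia. Qed.

(** * Distinctness of the vertices *)

Definition units4 : seq (int * int) := [:: (1, 0); (-1, 0); (0, 1); (0, -1)].

Lemma step_unit m k : step m k \in units4.
Proof.
elim: m k => [|m IHm] k.
  by rewrite step0.
rewrite (divn_eq k 8) mulnC stepS ?ltn_pmod //.
have : (k %% 8 < 8)%N by rewrite ltn_pmod.
move: (k %% 8)%N (step m _) (IHm (k %/ 8)%N) => i d.
rewrite !inE => /or4P[]/eqP-> i8;
by do 8?[case: i i8 => [//|i i8]].
Qed.

(* Residues modulo 4 determine whether a subdivided lattice edge is horizontal
   or vertical and, up to reversal of the edge ([i <-> 8 - i]), the index of the
   subdivision point on it. *)
Definition edge_check : bool :=
  all (fun d => all (fun e => all (fun i => all (fun j =>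
    let z := gmul d (gen_pos i) - gmul e (gen_pos j) in
    ((4 %| z.1)%Z && (4 %| z.2)%Z) ==>
    let q : int * int := ((z.1 %/ 4)%Z, (z.2 %/ 4)%Z) in
    (i == j) && (q == 0) || (e == - d) && (q == d))
  (iota 0 8)) (iota 0 8)) units4) units4.

Lemma edge_checkT : edge_check.
Proof. by vm_compute. Qed.

(** Only [(b - a) *+ 4] enters, as a difference of finitely many offsets, so [edge_check] decides
    the claim. The second alternative is one edge traversed in opposite directions. *)
Lemma subdivision_inj (a b d e : int * int) (i j : nat) :
  d \in units4 -> e \in units4 -> (i < 8)%N -> (j < 8)%N ->
  a *+ 4 + gmul d (gen_pos i) = b *+ 4 + gmul e (gen_pos j) ->
  (i = j /\ a = b) \/ (a + d = b /\ b + e = a).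
Proof.
move=> dU eU i8 j8 E.
have /allP/(_ d dU)/allP/(_ e eU)/allP/(_ i)  := edge_checkT.
rewrite mem_iota => /(_ i8)/allP/(_ j); rewrite mem_iota => /(_ j8).
have -> : gmul d (gen_pos i) - gmul e (gen_pos j) = (b - a) *+ 4.
  by rewrite -[gmul d _](addKr (a *+ 4)) E mulrnBl -addrA addrK addrC.
move: (b - a) (subrK a b) => [p q] <-.
rewrite (_ : (p, q) *+ 4 = (p * 4, q * 4)); last by congr pair; rewrite /=; ring.
rewrite /= !dvdz_mull //= !mulzK //.
case/orP => /andP[/eqP-> /eqP->]; first by left; rewrite add0r.
by right; rewrite addrC -addrA; split => //; rewrite addrCA addrN addr0.
Qed.

Lemma vertex_inj m : injective (vertex m).
Proof.
elim: m => [|m IHm] k l; first by case.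
rewrite (divn_eq k 8) (divn_eq l 8) ![(_ * 8)%N]mulnC.
rewrite !vertexS ?ltn_pmod // => /subdivision_inj.
case; rewrite ?step_unit ?ltn_pmod //; first by move=> [-> /IHm ->].
(* Opposite traversal would make each of [k %/ 8] and [l %/ 8] the successor of the other. *)
by rewrite /step ![_ + (_ - _)]addrC !subrK => -[/IHm + /IHm]; lia.
Qed.

Lemma vertex_mul8 m k : vertex m.+1 (8 * k) = vertex m k *+ 4.
Proof.
rewrite -[(8 * k)%N]addn0 vertexS //; case: (step m k) => a b.
rewrite (_ : gmul _ _ = 0) ?addr0 //.
by congr pair; rewrite /=; ring.
Qed.

(** * Points of [V m] and their adjacency in terms of indices *)

Definition point (R : realType) (m k : nat) : plane R :=
  ((vertex m k).1%:~R / 4 ^+ m, (vertex m k).2%:~R / 4 ^+ m).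

Lemma point_inj (R : realType) m : injective (point R m).
Proof.
have n0 : (4 ^+ m : R)^-1 != 0 by rewrite invr_neq0 // expf_neq0 // pnatr_eq0.
move=> k l [] /(mulIf n0)/eqP + /(mulIf n0)/eqP; rewrite !eqr_int => /eqP E1 /eqP E2.
by apply: (@vertex_inj m); rewrite (surjective_pairing (vertex m k)) E1 E2 -surjective_pairing.
Qed.

Lemma point_mul8 (R : realType) m k : point R m.+1 (8 * k) = point R m k.
Proof.
rewrite /point vertex_mul8; case: (vertex m k) => a b.
have n0 : (4 ^+ m : R) != 0 by rewrite expf_neq0 // pnatr_eq0.
congr pair; rewrite /= exprS; field; by rewrite ?n0 ?pnatr_eq0.
Qed.

Lemma f_formula (R : realType) (i : 'I_8) (Y : plane R) :
  f i Y = (((gen_dir i).1%:~R * Y.1 - (gen_dir i).2%:~R * Y.2 + (gen_pos i).1%:~R) / 4,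
           ((gen_dir i).2%:~R * Y.1 + (gen_dir i).1%:~R * Y.2 + (gen_pos i).2%:~R) / 4).
Proof.
have e3 : 3 * pi / 2 = pi / 2 + pi :> R by field.
rewrite /f (tnth_nth (@f1 R)).
case: i => -[|[|[|[|[|[|[|[|i]]]]]]]] // i8;
  rewrite /= /f1 /f2 /f3 /f4 /f5 /f6 /f7 /f8 /rot;
  case: Y => x y; congr pair; rewrite /= /GRing.scale /= ?e3 ?cosDpi ?sinDpi ?cos_pihalf ?sin_pihalf; by field.
Qed.

(** A word is read in base 8, first letter most significant; the value is the index of its edge
    along the curve. *)
Definition code (W : seq 'I_8) : nat := foldl (fun k (i : 'I_8) => 8 * k + i)%N 0%N W.

Lemma code_rcons W i : code (rcons W i) = (8 * code W + i)%N.
Proof. by rewrite /code foldl_rcons. Qed.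

Lemma code_lt W : (code W < 8 ^ size W)%N.
Proof.
elim/last_ind: W => // W i; rewrite code_rcons size_rcons expnS.
by have := ltn_ord i; lia.
Qed.

Lemma code_surj m k : (k < 8 ^ m)%N -> exists2 W : seq 'I_8, size W = m & code W = k.
Proof.
elim: m k => [|m IHm] k; first by rewrite ltnS leqn0 => /eqP->; exists [::].
rewrite expnSr -ltn_divLR // => /IHm[W sW cW].
exists (rcons W (Ordinal (ltn_pmod k (isT : 0 < 8)%N))).
  by rewrite size_rcons sW.
by rewrite code_rcons cW /= {3}(divn_eq k 8) mulnC.
Qed.

(** [f_word W] is the similarity carrying the unit segment to edge number [code W]. The induction
    appends letters at the end, because the innermost map subdivides the current edge. *)
Lemma f_word_formula (R : realType) (W : seq 'I_8) (Y : plane R) :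
  let t := vertex (size W) (code W) in
  let d := step (size W) (code W) in
  f_word W Y = ((d.1%:~R * Y.1 - d.2%:~R * Y.2 + t.1%:~R) / 4 ^+ size W,
                (d.2%:~R * Y.1 + d.1%:~R * Y.2 + t.2%:~R) / 4 ^+ size W).
Proof.
elim/last_ind: W Y => [|W i IHW] [x y].
  by rewrite step0; congr pair; rewrite /code /= expr0; field.
have -> : f_word (rcons W i) (x, y) = f_word W (f i (x, y)).
  by rewrite /f_word -cats1; elim: (W) => //= j W' ->.
rewrite IHW f_formula size_rcons code_rcons; cbv zeta; rewrite vertexS // stepS //.
have n0 : (4 ^+ size W : R) != 0 by rewrite expf_neq0 // pnatr_eq0.
case: (vertex _ _) (step _ _) => [a b] [c e].
case: (gen_pos i) (gen_dir i) => [p q] [r s].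
rewrite /gmul /= !exprS.
congr pair; rewrite /= !(rmorphD, rmorphB, rmorphM, rmorphMn) /=; field;
  by rewrite ?n0.
Qed.

Lemma f_word_P0 (R : realType) W : f_word W (P0 R) = point R (size W) (code W).
Proof. by rewrite f_word_formula /point /= !mulr0 subrr addr0 !add0r. Qed.

Lemma f_word_P1 (R : realType) W : f_word W (P1 R) = point R (size W) (code W).+1.
Proof.
rewrite f_word_formula /point /= !mulr0 subr0 addr0 !mulr1.
by rewrite /step -![_%:~R + _%:~R]rmorphD /= !subrK.
Qed.

Lemma mem_V (R : realType) m X :
  reflect (exists2 k, (k <= 8 ^ m)%N & X = point R m k) (X \in V R m).
Proof.
apply: (iffP idP).
  have : X \in V R m -> exists W, size W = m /\ (X = f_word W (P0 R) \/ X = f_word W (P1 R)).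
    elim: m X => [|m IHm] X.
      by rewrite !inE => /orP[]/eqP->; exists [::]; split => //; [left|right].
    move=> /VS_inv[i [Y [/IHm[W [sW YW]] ->]]]; exists (i :: W); split; first by rewrite /= sW.
    by case: YW => ->; [left|right].
  move=> /[apply] -[W [<- [] ->]].
    by exists (code W); [exact: ltnW (code_lt W)|exact: f_word_P0].
  by exists (code W).+1; [exact: code_lt|exact: f_word_P1].
have fV W p : p \in V R 0 -> f_word W p \in V R (size W).
  by move=> pV; elim: W => //= i W IHW; apply: in_VS.
case=> k; rewrite leq_eqVlt => /orP[/eqP-> ->|/code_surj[W <- <-] ->]; last first.
  by rewrite -f_word_P0; apply: fV; rewrite !inE eqxx.
(* The last vertex starts no edge of level [m]; it is the image of [P1] on the last edge. *)
have [|W sW cW] := @code_surj m (8 ^ m).-1; first by rewrite ltn_predL expn_gt0.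
have <- : (code W).+1 = (8 ^ m)%N by rewrite cW prednK // expn_gt0.
by rewrite -sW -f_word_P1; apply: fV; rewrite !inE eqxx orbT.
Qed.

Lemma mem_V0 (R : realType) m k :
  (point R m k \in V R 0) = (k == 0%N) || (k == 8 ^ m)%N.
Proof.
have p0 j : point R m (8 ^ m * j) = point R 0 j.
  elim: m => [|m IHm]; first by rewrite mul1n.
  by rewrite expnS -mulnA point_mul8.
have -> : V R 0 = [fset point R 0 0; point R 0 1]%fset.
  have := f_word_P0 R [::]; have := f_word_P1 R [::] => /=.
  by rewrite /f_word /= => <- <-.
by rewrite !inE -!p0 muln0 muln1 !(inj_eq (point_inj R m)).
Qed.

Lemma adj_point (R : realType) m j k : (j <= 8 ^ m)%N -> (k <= 8 ^ m)%N ->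
  adj m (point R m j) (point R m k) = (j == k.+1) || (k == j.+1).
Proof.
move=> jm km; apply/existsP/orP.
  case=> W /eqP; rewrite f_word_P0 f_word_P1 size_tuple => /fsetP E.
  (* Both ends of the edge have index [j] or [k]; being distinct, they exhaust the pair. *)
  have := E (point R m (code W)); have := E (point R m (code W).+1).
  rewrite !inE !(inj_eq (point_inj R m)) !eqxx orbT /=.
  move=> /orP[]/eqP h1 /orP[]/eqP h2; [lia| | |lia].
    by left; rewrite -h1 -h2.
  by right; rewrite -h1 -h2.
have edge l : (l < 8 ^ m)%N -> exists W : m.-tuple 'I_8,
    ([fset point R m l; point R m l.+1] = [fset f_word W (P0 R); f_word W (P1 R)])%fset.
  case/code_surj => W sW cW; have sW' : size W == m by rewrite sW.
  by exists (Tuple sW'); rewrite f_word_P0 f_word_P1 /= sW cW.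
case=> /eqP E; move: jm km; rewrite E => jm km.
  by have [W eW] := edge k jm; exists W; rewrite fsetUC eW.
by have [W eW] := edge j km; exists W; rewrite eW.
Qed.


(** * The eigenvalue equation as a recurrence on a path *)

(** The values of [u] along the curve; the default 0 is taken for [k > 8 ^ m]. *)
Definition path_fun (R : realType) m (u : V R m -> R) (k : nat) : R :=
  if insub (point R m k) is Some X then u X else 0.

Lemma path_funE (R : realType) m (u : V R m -> R) k (X : V R m) :
  val X = point R m k -> path_fun R m u k = u X.
Proof. by move=> eX; rewrite /path_fun -eX valK. Qed.

Lemma V_point (R : realType) m (X : V R m) :
  exists2 k, (k <= 8 ^ m)%N & val X = point R m k.
Proof. exact/mem_V/valP. Qed.

Lemma point_V (R : realType) m k : (k <= 8 ^ m)%N ->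
  exists X : V R m, val X = point R m k.
Proof.
move=> km; have kV : point R m k \in V R m by apply/mem_V; exists k.
by exists [` kV]%fset.
Qed.

(** An interior vertex has exactly two neighbours, distinct by injectivity of [point]. *)
Lemma Laplacian_path (R : realType) m (u : V R m -> R) k (X : V R m) :
  (k.+1 < 8 ^ m)%N -> val X = point R m k.+1 ->
  Laplacian u X = path_fun R m u k + path_fun R m u k.+2 - 2 * path_fun R m u k.+1.
Proof.
move=> km eX.
have [A eA] := @point_V R m k ltac:(lia).
have [B eB] := @point_V R m k.+2 ltac:(lia).
have nAB : B != A by rewrite -val_eqE eA eB (inj_eq (point_inj R m)); lia.
rewrite /Laplacian (eq_bigl (fun Y => (Y == A) || (Y == B))); last first.
  move=> Y; have [j jm eY] := V_point R m Y.
  rewrite eY eX adj_point //; last exact: ltnW.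
  by rewrite -!val_eqE eA eB eY !(inj_eq (point_inj R m)) eqSS orbC [k == j]eq_sym.
rewrite (bigD1 A) ?eqxx //= (bigD1 B) ?eqxx ?nAB ?orbT //= big1; last first.
  by move=> Y /andP[/andP[/orP[]/eqP->]]; rewrite eqxx.
by rewrite (path_funE _ _ _ _ _ eA) (path_funE _ _ _ _ _ eB) (path_funE _ _ _ _ _ eX); ring.
Qed.

Lemma path_fun_restrict (R : realType) m (u : V R m.+1 -> R) k : (k <= 8 ^ m)%N ->
  path_fun R m (@restrict_pred R m.+1 u) k = path_fun R m.+1 u (8 * k).
Proof.
move=> /(@point_V R)[X eX]; rewrite (path_funE _ _ _ _ _ eX) /restrict_pred.
by rewrite -(path_funE _ _ _ (8 * k)) //= point_mul8.
Qed.

Lemma eigen_recurrence (R : realType) m (lambda : R) (u : V R m -> R) :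
  (forall X : V R m, val X \notin V R 0 -> - Laplacian u X = lambda * u X) ->
  forall k, (k.+1 < 8 ^ m)%N ->
  path_fun R m u k + path_fun R m u k.+2 = (2 - lambda) * path_fun R m u k.+1.
Proof.
move=> hu k km; have [X eX] := @point_V R m k.+1 (ltnW km).
have := hu X; rewrite eX mem_V0 (ltn_eqF km) => /(_ isT).
rewrite (Laplacian_path _ _ _ k) // -(path_funE _ _ _ _ _ eX) => h.
by rewrite -[LHS]opprK; lra.
Qed.

(** * Passing to every eighth index *)

(** Adding the equations centred at [2k+1] and [2k+3] leaves [a] times the sum of the two odd terms,
    which the equation centred at [2k+2] evaluates. For [a = 2 cos t] this is angle doubling. *)
Lemma recurrence_double (R : comPzRingType) (w : nat -> R) (a : R) (N : nat) :
  (forall k, (k.+1 < 2 * N)%N -> w k + w k.+2 = a * w k.+1) ->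
  forall k, (k.+1 < N)%N ->
  w (2 * k)%N + w (2 * k.+2)%N = (a ^+ 2 - 2) * w (2 * k.+1)%N.
Proof.
move=> h k kN.
have h1 := h (2 * k)%N ltac:(lia).
have h2 := h (2 * k).+1 ltac:(lia).
have h3 := h (2 * k).+2 ltac:(lia).
rewrite (_ : 2 * k.+2 = (2 * k).+4)%N; last lia.
rewrite (_ : 2 * k.+1 = (2 * k).+2)%N; last lia.
have -> : w (2 * k)%N = a * w (2 * k).+1 - w (2 * k).+2 by rewrite -h1 addrK.
have -> : w (2 * k).+4 = a * w (2 * k).+3 - w (2 * k).+2 by rewrite -h3 addrC addKr.
by rewrite addrACA -mulrDr h2; ring.
Qed.

Lemma recurrence_octuple (R : comPzRingType) (w : nat -> R) (a : R) (N : nat) :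
  (forall k, (k.+1 < 8 * N)%N -> w k + w k.+2 = a * w k.+1) ->
  forall k, (k.+1 < N)%N ->
  w (8 * k)%N + w (8 * k.+2)%N = (((a ^+ 2 - 2) ^+ 2 - 2) ^+ 2 - 2) * w (8 * k.+1)%N.
Proof.
rewrite -(mulnA 2 4) -(mulnA 2 2) => /recurrence_double.
move=> /(recurrence_double _ (fun k => w (2 * k)%N)).
move=> /(recurrence_double _ (fun k => w (2 * (2 * k))%N)) h k /h.
by rewrite !mulnA.
Qed.

Theorem mainTheorem1 (R : realType) (m : nat) (hm : (2 <= m)%N)
    (lambda_m lambda_m1 : R)
    (hlambda : lambda_m \notin
       [:: 2;
           2 + Num.sqrt 2; 2 - Num.sqrt 2;
           2 + Num.sqrt (2 + Num.sqrt 2); 2 - Num.sqrt (2 + Num.sqrt 2);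
           2 + Num.sqrt (2 - Num.sqrt 2); 2 - Num.sqrt (2 - Num.sqrt 2)])
    (u : V R m -> R)
    (hu : forall X : V R m, val X \notin V R 0 ->
       - Laplacian u X = lambda_m * u X)
    (hnz : exists X : V R m.-1, restrict_pred u X <> 0)
    (hu1 : forall X : V R m.-1, val X \notin V R 0 ->
       - Laplacian (restrict_pred u) X = lambda_m1 * restrict_pred u X) :
  lambda_m1 =
    - (lambda_m - 4) * (lambda_m - 2) ^+ 2 * lambda_m *
      ((lambda_m - 4) * lambda_m + 2) ^+ 2.
Proof.
case: m hm u hu hnz hu1 => [//|n] n0 u hu [X uX] hu1.
set v := path_fun R n (@restrict_pred R n.+1 u).
have rec1 : forall k, (k.+1 < 8 ^ n)%N -> v k + v k.+2 = (2 - lambda_m1) * v k.+1.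
  exact: eigen_recurrence hu1.
have rec8 k : (k.+1 < 8 ^ n)%N -> v k + v k.+2 =
    ((((2 - lambda_m) ^+ 2 - 2) ^+ 2 - 2) ^+ 2 - 2) * v k.+1.
  move=> kn; rewrite /v !path_fun_restrict; try lia.
  move: k kn; apply: recurrence_octuple; rewrite -expnS.
  exact: eigen_recurrence hu.
(* Since [n >= 1], the two indices next to either end point are interior. *)
have n8 : (8 <= 8 ^ n)%N by rewrite -{1}(expn1 8) leq_exp2l.
have [k kn vk] : exists2 k, (k.+1 < 8 ^ n)%N & v k.+1 <> 0.
  apply: contrapT => noint.
  have v0 k : (k.+1 < 8 ^ n)%N -> v k.+1 = 0.
    by move=> kn; apply: contrapT => vk; apply: noint; exists k.
  have [k kn eX] := V_point R n X.
  apply: uX; rewrite -(path_funE _ _ _ _ _ eX) -/v.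
  case: k kn {eX} => [_|k].
    by have := rec1 0%N ltac:(lia); rewrite !v0 ?mulr0 ?addr0 //; lia.
  rewrite leq_eqVlt => /orP[/eqP kn|]; last exact: v0.
  case: k kn => [|[|k]] kn; try lia.
  by have := rec1 k.+1 ltac:(lia); rewrite (v0 k) ?(v0 k.+1) ?mulr0 ?add0r //; lia.
(* Both recurrences have the same left side at [k], so cancelling [v k.+1] equates their
   coefficients. *)
have := rec8 k kn; rewrite rec1 // => /(mulIf (introN eqP vk)) E.
have <- : 2 - (2 - lambda_m1) = lambda_m1 by ring.
(* With [a = 2 - lambda_m] and [d = a ^+ 2 - 2], the right side becomes
   [(4 - a ^+ 2) * a ^+ 2 * d ^+ 2], by repeated use of [2 - (c ^+ 2 - 2) = (2 - c) * (2 + c)]. *)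
by rewrite E; ring.
Qed.
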